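(* Let $0<\alpha\le1$. For $u\in C^{\alpha}([a,b])$ let $$ c_{j}^{N}[u] = \frac1{i\pi}\Big(\mathrm{p.v.}\!\int_{a}^{b} \frac{u(y)}{y-x_{j}}dy - h\sum_{n\in\omega^{N}\setminus\{j\}}\frac{u(x_{n})}{x_{n}-x_{j}}\Big),\qquad j\in\omega^{N}. $$ Then for all $j\in\omega^N$ $$ |c_{j}^{N}[u]| \le C\,\Big( h^{\alpha}|\log h|\, \|u\|_{C^{\alpha}([a,b])} + |u(x_{j})| \frac{h^{2}}{(x_{j}-a)^{2}(b-x_{j})^{2}} \Big)\,. $$ Here the constant $C$ depends on $a,b$ but not on $h=\frac1N$ nor on $u$. If, in addition, $u(a)=u(b)=0$ holds, then the estimate simplifies to $$ |c_{j}^{N}[u]| \le C\, h^{\alpha}|\log h|\, \|u\|_{C^{\alpha}([a,b])}\,. $$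
   Context: Let $a<b$ be real numbers, $N\in\mathbb N$ and $h=\frac1N$. It is assumed that $b-a=Mh$ with $M\in\mathbb N$, and one sets $\omega^N=\{1,\dots,M\}$ and $x_j=a+(j-\tfrac12)h$ for $j\in\omega^N$, so that $x_1=a+\frac h2$, $x_M=b-\frac h2$, and the $x_j$ are the midpoints of the $M$ subintervals of length $h$ dividing $(a,b)$. $C^\alpha([a,b])$ is the space of functions that are H\''older continuous of exponent $\alpha$ on $[a,b]$ (Lipschitz continuous when $\alpha=1$), with its usual norm $\|u\|_{C^\alpha([a,b])}=\sup_{[a,b]}|u|+\sup_{x\ne y}\frac{|u(x)-u(y)|}{|x-y|^\alpha}$. The notation $\mathrm{p.v.}\int$ denotes the Cauchy principal value integral, i.e. $\lim_{\varepsilon\to0+}\int_{\{y\in(a,b):\,|y-x_j|>\varepsilon\}}$. The vector $c^N[u]=(c_j^N[u])_{j\in\omega^N}$ is called the consistency error; it is the quadrature error of the midpoint rectangle rule applied to the Cauchy singular integral.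
   Formalization: The case N=1 is excluded: there h=1 and |log h|=0, and the bounds fail (e.g. a=0, b=1, u(y)=sin(2πy)); the constant C may also depend on α, since a bound uniform as α→0 is false. *)

(* Defs.v *)
From Stdlib Require Import Reals.
From Coquelicot Require Import Coquelicot.

Open Scope R_scope.

(* Functions on [a,b] are represented by total functions [R -> C]; nothing below
   looks at values outside [a,b]. *)

Definition holder (alpha a b : R) (u : R -> C) : Prop :=
  exists K : R, forall x y : R,
    a <= x <= b -> a <= y <= b -> x <> y ->
    Cmod (u x - u y) <= K * Rpower (Rabs (x - y)) alpha.

Definition Rsup (E : R -> Prop) : R := real (Lub_Rbar E).

(* The case x = y is left out of the quotient: [Rpower 0 alpha] is 1, not 0. *)
Definition holder_norm (alpha a b : R) (u : R -> C) : R :=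
  Rsup (fun r => exists x : R, a <= x <= b /\ r = Cmod (u x)) +
  Rsup (fun r => exists x y : R,
          a <= x <= b /\ a <= y <= b /\ x <> y /\
          r = Cmod (u x - u y) / Rpower (Rabs (x - y)) alpha).

Definition cut_off (f : R -> C) (x eps : R) : R -> C :=
  fun y => if Rlt_dec eps (Rabs (y - x)) then f y else RtoC 0.

Definition is_pv (f : R -> C) (a b x : R) (l : C) : Prop :=
  filterlim (fun eps : R => RInt (V := C_R_CompleteNormedModule) (cut_off f x eps) a b)
    (at_right 0) (locally (T := C_R_CompleteNormedModule) l).

(* As for [RInt], a total function, meaningful when [is_pv f a b x l] holds for some l. *)
Definition pv (f : R -> C) (a b x : R) : C :=
  iota (T := C_R_CompleteNormedModule) (is_pv f a b x).

Definition mesh (N : nat) : R := 1 / INR N.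

Definition midpoint (a : R) (N j : nat) : R := a + (INR j - 1 / 2) * mesh N.

Definition quadrature_sum (a : R) (N M : nat) (u : R -> C) (j : nat) : C :=
  (mesh N *
   sum_n_m (G := C_AbelianMonoid)
     (fun n => if Nat.eqb n j then RtoC 0
               else (u (midpoint a N n) / (midpoint a N n - midpoint a N j))%C)
     1 M)%C.

Definition consistency_error (a b : R) (N M : nat) (u : R -> C) (j : nat) : C :=
  (1 / (Ci * PI) *
   (pv (fun y => u y / (y - midpoint a N j)) a b (midpoint a N j)
    - quadrature_sum a N M u j))%C.

(* Main.v *)
(* With x = x_j, write the truncated integral as the integral over t > eps of
   v(x+t)/t on [eps, (q+1/2)h] minus that of v(x-t)/t on [eps, (p+1/2)h], where
   p = j-1 and q = M-j.  On t < h/2 the difference (v(x+t) - v(x-t))/t is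
   O(t^(alpha-1)), which gives the principal value and an O(h^alpha) contribution.
   On the cell around t = kh, the midpoint rule applied to (w(t) - w(0))/t errs by
   O(h^alpha/k), and these sum to O(h^alpha |log h|).  What remains is w(0) = v(x)
   times the defects ln((k+1/2)/(k-1/2)) - 1/k; they cancel between the two sides up
   to O(1/(p+1/2)^2 + 1/(q+1/2)^2), which is the second term of the estimate.  If u
   vanishes at the end points, then |u(x)| <= H ((p+1/2)h)^alpha, and likewise for q,
   so that this term is O(h^alpha). *)

Require Import Defs.
From Stdlib Require Import Reals Lra Lia.
From Coquelicot Require Import Coquelicot.
Open Scope R_scope.

(** * Hoelder functions on the real line *)

(** Since [Rpower 0 alpha] is 1, the inequality at [x = y] only says [0 <= H]. *)
Definition holder_on_R (alpha H : R) (v : R -> R) : Prop :=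
  forall x y : R, Rabs (v x - v y) <= H * Rpower (Rabs (x - y)) alpha.

Lemma holder_const_ge0 (alpha H : R) (v : R -> R) :
  holder_on_R alpha H v -> 0 <= H.
Proof.
intros Hv; specialize (Hv 0 1).
assert (Hp := exp_pos (alpha * ln (Rabs (0 - 1)))).
assert (Ha := Rabs_pos (v 0 - v 1)).
unfold Rpower in Hv; nra.
Qed.

Lemma Rpower_gt0 (x y : R) : 0 < Rpower x y.
Proof. apply exp_pos. Qed.

Lemma Rpower_small (alpha H eps : R) :
  0 < alpha -> 0 <= H -> 0 < eps ->
  exists eta : posreal, forall t : R, 0 < t < eta -> H * Rpower t alpha < eps.
Proof.
intros Ha HH He.
(* Dividing by [H + 1] instead of [H] covers the case [H = 0]. *)
assert (Hq : 0 < eps / (H + 1)) by (apply Rdiv_lt_0_compat; lra).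
exists (mkposreal _ (Rpower_gt0 (eps / (H + 1)) (/ alpha))); simpl; intros t Ht.
assert (Hl : Rpower t alpha < eps / (H + 1)).
{ rewrite <- (Rpower_1 (eps / (H + 1))) by exact Hq.
  replace 1 with (/ alpha * alpha) at 2 by (field; lra).
  rewrite <- Rpower_mult.
  apply Rlt_Rpower_l; lra. }
assert (Hp := Rpower_gt0 t alpha).
assert (E : eps / (H + 1) * (H + 1) = eps) by (field; lra).
nra.
Qed.

Lemma holder_on_R_continuous (alpha H : R) (v : R -> R) (x : R) :
  0 < alpha -> holder_on_R alpha H v -> continuous v x.
Proof.
intros Ha Hv.
apply filterlim_locally; intros eps.
destruct (Rpower_small alpha H eps Ha (holder_const_ge0 _ _ _ Hv) (cond_pos eps))
  as [eta Heta].
exists eta; intros y Hy.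
change (Rabs (y - x) < eta) in Hy; change (Rabs (v y - v x) < eps).
(* At coinciding points the Hoelder bound is the constant [H], which is not small. *)
destruct (Req_dec y x) as [->|Hn].
- replace (v x - v x) with 0 by ring; rewrite Rabs_R0; apply cond_pos.
- eapply Rle_lt_trans; [apply Hv|].
  apply Heta; split; [apply Rabs_pos_lt; lra | exact Hy].
Qed.

(** * Logarithmic defects and harmonic sums *)

(** Error of the midpoint rule for 1/t on the cell from (k-1/2)h to (k+1/2)h; it does not depend on
    h. *)
Definition log_defect (k : R) : R := ln (k + 1 / 2) - ln (k - 1 / 2) - / k.

(** The function vanishes at 0 and has derivative 2z^2/(1-z^2), which lies between 0 and 48z^2, the
    derivative of 16z^3. The constant 16 is generous: at t = 1/(2k) it gives 2/k^3, the form that is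
    compared with a difference of inverse squares. *)
Lemma ln_ratio_bounds (t : R) : 0 < t <= 1 / 2 ->
  0 <= ln (1 + t) - ln (1 - t) - 2 * t <= 16 * t ^ 3.
Proof.
intros Ht.
assert (D : forall z, 0 <= z <= t ->
  is_derive (fun z => ln (1 + z) - ln (1 - z) - 2 * z) z (2 * z ^ 2 / (1 - z ^ 2))).
{ intros z Hz; auto_derive; [lra|field; nra]. }
assert (B : forall z, 0 <= z <= t -> 0 <= 2 * z ^ 2 / (1 - z ^ 2) <= 48 * z ^ 2).
{ intros z Hz; assert (0 <= z ^ 2 <= / 4) by nra.
  generalize dependent (z ^ 2); intros s Hs; split.
  - apply Rdiv_le_0_compat; lra.
  - apply Rle_div_l; nra. }
assert (Z : ln (1 + 0) - ln (1 - 0) - 2 * 0 = 0) by (rewrite Rplus_0_r, Rminus_0_r; lra).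
split.
- destruct (MVT_gen (fun z => ln (1 + z) - ln (1 - z) - 2 * z) 0 t
    (fun z => 2 * z ^ 2 / (1 - z ^ 2))) as [c [Hc Ec]].
  + intros z; rewrite Rmin_left, Rmax_right by lra; intros; apply D; lra.
  + intros z; rewrite Rmin_left, Rmax_right by lra; intros.
    apply derivable_continuous_pt, ex_derive_Reals_0.
    auto_derive; lra.
  + rewrite Rmin_left, Rmax_right in Hc by lra.
    rewrite Z in Ec; specialize (B c Hc); nra.
- destruct (MVT_gen (fun z => ln (1 + z) - ln (1 - z) - 2 * z - 16 * z ^ 3) 0 t
    (fun z => 2 * z ^ 2 / (1 - z ^ 2) - 48 * z ^ 2)) as [c [Hc Ec]].
  + intros z; rewrite Rmin_left, Rmax_right by lra; intros.
    auto_derive; [lra|field; nra].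
  + intros z; rewrite Rmin_left, Rmax_right by lra; intros.
    apply derivable_continuous_pt, ex_derive_Reals_0.
    auto_derive; lra.
  + rewrite Rmin_left, Rmax_right in Hc by lra.
    rewrite Z in Ec; specialize (B c Hc); nra.
Qed.

(* The upper bound has the size [1 / k ^ 3] of the defect and telescopes. *)
Lemma log_defect_bounds (k : R) : 1 <= k ->
  0 <= log_defect k <= / (k - 1 / 2) ^ 2 - / (k + 1 / 2) ^ 2.
Proof.
intros Hk.
assert (Hik : 0 < / k) by (apply Rinv_0_lt_compat; lra).
assert (Hik1 : / k <= 1) by (rewrite <- Rinv_1; apply Rinv_le_contravar; lra).
destruct (ln_ratio_bounds (/ k / 2)) as [B1 B2]; [lra|].
assert (E : log_defect k = ln (1 + / k / 2) - ln (1 - / k / 2) - 2 * (/ k / 2)).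
{ unfold log_defect.
  replace (k + 1 / 2) with (k * (1 + / k / 2)) by (field; lra).
  replace (k - 1 / 2) with (k * (1 - / k / 2)) by (field; lra).
  rewrite !ln_mult by lra; lra. }
rewrite E; split; [exact B1|].
eapply Rle_trans; [exact B2|].
(* Both sides become 2k over a square, with denominators (k^2-1/4)^2 and k^4. *)
replace (/ (k - 1 / 2) ^ 2 - / (k + 1 / 2) ^ 2)
  with (2 * k / (k ^ 2 - / 4) ^ 2) by (field; split; [nra|split; nra]).
replace (16 * (/ k / 2) ^ 3) with (2 * k / k ^ 4) by (field; lra).
apply Rmult_le_compat_l; [lra|].
apply Rinv_le_contravar.
- apply pow_lt; nra.
- replace (k ^ 4) with ((k ^ 2) ^ 2) by ring; apply pow_incr; nra.
Qed.

(** Telescoping: the bound for one cell ends at the inverse square where the bound for the next one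
    begins. *)
Lemma sum_log_defect_bounds (p d : nat) :
  0 <= sum_n_m (fun k => log_defect (INR k)) 1 (p + d) -
       sum_n_m (fun k => log_defect (INR k)) 1 p
    <= / (INR p + 1 / 2) ^ 2 - / (INR (p + d) + 1 / 2) ^ 2.
Proof.
induction d as [|d IH].
- rewrite Nat.add_0_r; lra.
- rewrite Nat.add_succ_r, sum_n_Sm by lia.
  change plus with Rplus.
  assert (B := log_defect_bounds (INR (S (p + d)))).
  rewrite S_INR in *; assert (P := pos_INR (p + d)).
  replace (INR (p + d) + 1 - 1 / 2) with (INR (p + d) + 1 / 2) in B by lra.
  lra.
Qed.

(** The common initial terms cancel. The remaining terms start beyond min(p,q), so they are
    controlled by the inverse square of the shorter side; the sum of both inverse squares keeps the
    bound symmetric. *)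
Lemma sum_log_defect_diff (p q : nat) :
  Rabs (sum_n_m (fun k => log_defect (INR k)) 1 q -
       sum_n_m (fun k => log_defect (INR k)) 1 p)
    <= / (INR p + 1 / 2) ^ 2 + / (INR q + 1 / 2) ^ 2.
Proof.
assert (Hpos : forall n, 0 < / (INR n + 1 / 2) ^ 2).
{ intros n; assert (P := pos_INR n).
  apply Rinv_0_lt_compat, pow_lt; lra. }
assert (Hp := Hpos p); assert (Hq := Hpos q).
destruct (Nat.le_ge_cases p q) as [L|L].
- assert (B := sum_log_defect_bounds p (q - p)).
  replace (p + (q - p))%nat with q in B by lia.
  apply Rabs_le; lra.
- assert (B := sum_log_defect_bounds q (p - q)).
  replace (q + (p - q))%nat with p in B by lia.
  apply Rabs_le; lra.
Qed.

(** This is exp z >= 1 + z at z = ln(k/(k+1)). *)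
Lemma ln_step (k : R) : 1 <= k -> / (k + 1) <= ln (k + 1) - ln k.
Proof.
intros Hk.
assert (E := exp_ineq1_le (ln k + - ln (k + 1))).
rewrite exp_plus, exp_Ropp, !exp_ln in E by lra.
replace (/ (k + 1)) with (1 - k * / (k + 1)) by (field; lra).
lra.
Qed.

(** As 1/(k-1/2) <= 2/k, the sum is at most twice a harmonic sum. Bounding by [M], the total number
    of nodes, lets one estimate serve both sides of the singular node, even an empty one. *)
Lemma sum_half_harmonic_le (q M : nat) : (q < M)%nat ->
  sum_n_m (fun k => / (INR k - 1 / 2)) 1 q <= 2 + 2 * ln (INR M).
Proof.
intros HM.
assert (Hs : forall n, sum_n_m (fun k => / (INR k - 1 / 2)) 1 (S n)
                         <= 2 + 2 * ln (INR (S n))).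
{ induction n as [|n IH].
  - rewrite sum_n_n; simpl; rewrite ln_1; lra.
  - rewrite sum_n_Sm by lia; change plus with Rplus.
    assert (P := pos_INR n).
    assert (L := ln_step (INR (S n))).
    rewrite (S_INR (S n)); rewrite S_INR in *.
    assert (/ (INR n + 1 + 1 - 1 / 2) <= 2 * / (INR n + 1 + 1)).
    { replace (2 * / (INR n + 1 + 1)) with (/ ((INR n + 1 + 1) / 2)) by (field; lra).
      apply Rinv_le_contravar; lra. }
    lra. }
destruct q as [|q].
- rewrite sum_n_m_zero by lia; change zero with 0.
  assert (1 <= INR M) by (apply (le_INR 1); lia).
  assert (0 <= ln (INR M)) by (rewrite <- ln_1; apply Rcomplements.ln_le; lra).
  lra.
- eapply Rle_trans; [apply Hs|].
  assert (ln (INR (S q)) <= ln (INR M)).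
  { apply Rcomplements.ln_le; [apply lt_0_INR; lia | apply le_INR; lia]. }
  lra.
Qed.

(** * The midpoint rule for w(t)/t away from t = 0 *)

Lemma ex_RInt_over_id (w : R -> R) (lo hi : R) :
  (forall t, continuous w t) -> 0 < lo <= hi -> ex_RInt (fun t => w t / t) lo hi.
Proof.
intros Hw H.
apply (ex_RInt_continuous (V := R_CompleteNormedModule)); intros t.
rewrite Rmin_left, Rmax_right by lra; intros Ht.
apply (continuous_mult (K := R_AbsRing)); [apply Hw|].
apply continuous_Rinv; lra.
Qed.

Lemma is_RInt_Rinv (lo hi : R) : 0 < lo <= hi -> is_RInt Rinv lo hi (ln hi - ln lo).
Proof.
intros H.
apply (is_RInt_derive (V := R_CompleteNormedModule) ln Rinv);
  rewrite Rmin_left, Rmax_right by lra; intros t Ht.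
- auto_derive; [lra|field; lra].
- apply continuous_Rinv; lra.
Qed.

(** Subtracting w(0) is essential: the difference quotient changes over the cell by the oscillation
    of w, of size h^alpha, and by the change of 1/t times w(kh)-w(0), which is at most k h^alpha up
    to [H]. Both are O(h^alpha/t). *)
Lemma cell_integrand_bound (alpha H : R) (w : R -> R) (h k t : R) :
  0 < alpha <= 1 -> holder_on_R alpha H w -> 0 < h -> 1 <= k ->
  (k - 1 / 2) * h <= t <= (k + 1 / 2) * h ->
  Rabs ((w t - w 0) / t - (w (k * h) - w 0) / (k * h))
    <= 2 * H * Rpower h alpha * / ((k - 1 / 2) * h).
Proof.
intros Ha Hw Hh Hk Ht.
assert (HH := holder_const_ge0 _ _ _ Hw).
assert (Hlo : 0 < (k - 1 / 2) * h) by (apply Rmult_lt_0_compat; lra).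
assert (Hkh : 0 < k * h) by (apply Rmult_lt_0_compat; lra).
assert (Hd : Rabs (t - k * h) <= h / 2) by (apply Rabs_le; lra).
assert (Hp := Rpower_gt0 h alpha).
assert (B1 : Rabs (w t - w (k * h)) <= H * Rpower h alpha).
{ destruct (Req_dec t (k * h)) as [->|Hn].
  - replace (w (k * h) - w (k * h)) with 0 by ring; rewrite Rabs_R0; nra.
  - eapply Rle_trans; [apply Hw|].
    apply Rmult_le_compat_l; [exact HH|].
    apply Rle_Rpower_l; [lra|].
    split; [apply Rabs_pos_lt; lra | lra]. }
(* Uses k^alpha <= k, valid for k >= 1 and alpha <= 1; this k cancels against the one in 1/(kh). *)
assert (B2 : Rabs (w (k * h) - w 0) <= H * (k * Rpower h alpha)).
{ eapply Rle_trans; [apply Hw|].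
  apply Rmult_le_compat_l; [exact HH|].
  rewrite Rminus_0_r, Rabs_pos_eq by lra.
  rewrite <- Rpower_mult_distr by lra.
  apply Rmult_le_compat_r; [lra|].
  rewrite <- (Rpower_1 k) at 2 by lra.
  apply Rle_Rpower; lra. }
replace ((w t - w 0) / t - (w (k * h) - w 0) / (k * h))
  with ((w t - w (k * h)) * / t + (w (k * h) - w 0) * / (k * h) * (k * h - t) * / t)
  by (field; lra).
assert (Hit : 0 < / t) by (apply Rinv_0_lt_compat; lra).
assert (Hitle : / t <= / ((k - 1 / 2) * h)) by (apply Rinv_le_contravar; lra).
eapply Rle_trans; [apply Rabs_triang|].
rewrite !Rabs_mult, (Rabs_pos_eq (/ t)), (Rabs_pos_eq (/ (k * h)))
  by (left; try exact Hit; apply Rinv_0_lt_compat, Hkh).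
rewrite (Rabs_minus_sym (k * h) t).
assert (C1 : Rabs (w t - w (k * h)) * / t <= H * Rpower h alpha * / t)
  by (apply Rmult_le_compat_r; lra).
assert (C2 : Rabs (w (k * h) - w 0) * / (k * h) * Rabs (t - k * h) * / t
             <= H * (k * Rpower h alpha) * / (k * h) * (h / 2) * / t).
{ apply Rmult_le_compat_r; [lra|].
  assert (0 < / (k * h)) by (apply Rinv_0_lt_compat, Hkh).
  apply Rmult_le_compat; [|apply Rabs_pos| |exact Hd].
  - apply Rmult_le_pos; [apply Rabs_pos|lra].
  - apply Rmult_le_compat_r; lra. }
(* The second term is half the bound of the first, so 3/2 would do in place of 2. *)
replace (H * (k * Rpower h alpha) * / (k * h) * (h / 2) * / t)
  with (H * Rpower h alpha * / t / 2) in C2 by (field; lra).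
assert (C3 : H * Rpower h alpha * / t <= H * Rpower h alpha * / ((k - 1 / 2) * h))
  by (apply Rmult_le_compat_l; [nra|lra]).
assert (0 <= H * Rpower h alpha * / t) by (apply Rmult_le_pos; nra).
lra.
Qed.

(** Integrating the pointwise bound over a cell of length h removes the factor 1/h. The part w(0)/t
    is integrated exactly and, against its midpoint value, leaves the logarithmic defect. *)
Lemma cell_error (alpha H : R) (w : R -> R) (h k : R) :
  0 < alpha <= 1 -> holder_on_R alpha H w -> 0 < h -> 1 <= k ->
  Rabs (RInt (fun t => w t / t) ((k - 1 / 2) * h) ((k + 1 / 2) * h)
        - w (k * h) / k - w 0 * log_defect k)
    <= 2 * H * Rpower h alpha * / (k - 1 / 2).
Proof.
intros Ha Hw Hh Hk.
assert (Hlo : 0 < (k - 1 / 2) * h) by (apply Rmult_lt_0_compat; lra).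
assert (Hlh : (k - 1 / 2) * h <= (k + 1 / 2) * h) by (apply Rmult_le_compat_r; lra).
assert (I1 : is_RInt (fun t => w t / t) ((k - 1 / 2) * h) ((k + 1 / 2) * h)
               (RInt (fun t => w t / t) ((k - 1 / 2) * h) ((k + 1 / 2) * h))).
{ apply (RInt_correct (V := R_CompleteNormedModule)), ex_RInt_over_id; [|lra].
  intros t; apply (holder_on_R_continuous alpha H); [lra|exact Hw]. }
assert (I2 := is_RInt_scal _ _ _ (w 0) _ (is_RInt_Rinv _ _ (conj Hlo Hlh))).
assert (I3 := is_RInt_const (V := R_NormedModule) ((k - 1 / 2) * h) ((k + 1 / 2) * h)
                ((w (k * h) - w 0) / (k * h))).
assert (I4 := is_RInt_minus _ _ _ _ _ _ (is_RInt_minus _ _ _ _ _ _ I1 I2) I3).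
assert (Hpt : forall t, (k - 1 / 2) * h <= t <= (k + 1 / 2) * h ->
  Rabs (w t / t - w 0 * / t - (w (k * h) - w 0) / (k * h))
    <= 2 * H * Rpower h alpha * / ((k - 1 / 2) * h)).
{ intros t Ht.
  replace (w t / t - w 0 * / t) with ((w t - w 0) / t) by (unfold Rdiv; ring).
  apply cell_integrand_bound; assumption. }
assert (B := norm_RInt_le_const (V := R_NormedModule) _ _ _ _ _ Hlh Hpt I4).
change (norm (V := R_NormedModule)) with Rabs in B.
match type of B with Rabs ?X <= ?Y =>
  replace X with (RInt (fun t => w t / t) ((k - 1 / 2) * h) ((k + 1 / 2) * h)
        - w (k * h) / k - w 0 * log_defect k) in B;
  [replace Y with (2 * H * Rpower h alpha * / (k - 1 / 2)) in B by (field; lra)|]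
end.
- exact B.
- unfold minus, plus, opp, scal, log_defect; simpl; unfold mult; simpl.
  rewrite !ln_mult by lra; field; lra.
Qed.

(** Sums the cell errors. The first cell starts at h/2, so for [q = 0] the interval is a single
    point. *)
Lemma midpoint_rule_error (alpha H : R) (w : R -> R) (h : R) (q : nat) :
  0 < alpha <= 1 -> holder_on_R alpha H w -> 0 < h ->
  Rabs (RInt (fun t => w t / t) (h / 2) ((INR q + 1 / 2) * h)
        - sum_n_m (fun k => w (INR k * h) / INR k) 1 q
        - w 0 * sum_n_m (fun k => log_defect (INR k)) 1 q)
    <= 2 * H * Rpower h alpha * sum_n_m (fun k => / (INR k - 1 / 2)) 1 q.
Proof.
intros Ha Hw Hh.
assert (Hc : forall t, continuous w t)
  by (intros t; apply (holder_on_R_continuous alpha H); [lra|exact Hw]).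
induction q as [|q IH].
- rewrite !sum_n_m_zero by lia; change zero with 0.
  replace ((INR 0 + 1 / 2) * h) with (h / 2) by (simpl; field).
  rewrite RInt_point; change zero with 0.
  replace (0 - 0 - w 0 * 0) with 0 by ring; rewrite Rabs_R0; lra.
- rewrite !sum_n_Sm by lia; change plus with Rplus.
  assert (B := cell_error alpha H w h (INR (S q)) Ha Hw Hh (le_INR 1 (S q) ltac:(lia))).
  assert (P : 0 <= INR q * h) by (apply Rmult_le_pos; [apply pos_INR|lra]).
  assert (Eq : (INR (S q) - 1 / 2) * h = (INR q + 1 / 2) * h)
    by (rewrite S_INR; field).
  rewrite Eq in B.
  rewrite <- (RInt_Chasles (V := R_CompleteNormedModule) _ _ ((INR q + 1 / 2) * h)).
  + change plus with Rplus.
    match goal with |- Rabs ?X <= ?Y =>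
      match type of IH with Rabs ?X1 <= _ => match type of B with Rabs ?X2 <= _ =>
        replace X with (X1 + X2) by ring
      end end end.
    eapply Rle_trans; [apply Rabs_triang|]; lra.
  + apply ex_RInt_over_id; [exact Hc|]; split; lra.
  + apply ex_RInt_over_id; [exact Hc|].
    rewrite <- Eq; split; [rewrite Eq; lra|].
    apply Rmult_le_compat_r; lra.
Qed.

(** * Limits of truncated integrals at the singularity *)

Lemma at_right_0_lt (d : R) : 0 < d -> at_right 0 (fun t => 0 < t < d).
Proof.
intros Hd; exists (mkposreal d Hd); intros t Ht Ht0.
change (Rabs (t - 0) < d) in Ht.
rewrite Rminus_0_r, Rabs_pos_eq in Ht; lra.
Qed.

(** The dominating function D t^(alpha-1) has the primitive (D/alpha) t^alpha, which tends to 0 at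
    0. This gives both the Cauchy property and the bound, which then passes to the limit. *)
Lemma weakly_singular_limit (alpha D delta : R) (phi : R -> R) :
  0 < alpha -> 0 <= D -> 0 < delta ->
  (forall t, 0 < t <= delta -> continuous phi t) ->
  (forall t, 0 < t <= delta -> Rabs (phi t) <= D * Rpower t (alpha - 1)) ->
  exists l : R,
    filterlim (fun eps => RInt phi eps delta) (at_right 0) (locally l) /\
    Rabs l <= D / alpha * Rpower delta alpha.
Proof.
intros Ha HD Hdelta Hc Hb.
assert (HDa : 0 <= D / alpha) by (apply Rdiv_le_0_compat; lra).
assert (Hex : forall e1 e2, 0 < e1 -> e1 <= e2 <= delta -> ex_RInt phi e1 e2).
{ intros e1 e2 H1 H2; apply (ex_RInt_continuous (V := R_CompleteNormedModule)).
  rewrite Rmin_left, Rmax_right by lra; intros t Ht; apply Hc; lra. }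
assert (Hint : forall e1 e2, 0 < e1 -> e1 <= e2 <= delta ->
  Rabs (RInt phi e1 e2) <= D / alpha * Rpower e2 alpha).
{ intros e1 e2 H1 H2.
  assert (I : is_RInt (fun t => D * Rpower t (alpha - 1)) e1 e2
     (D / alpha * Rpower e2 alpha - D / alpha * Rpower e1 alpha)).
  { apply (is_RInt_derive (V := R_CompleteNormedModule)
      (fun t => D / alpha * Rpower t alpha));
    rewrite Rmin_left, Rmax_right by lra; intros t Ht; unfold Rpower.
    - auto_derive; [lra|].
      replace ((alpha - 1) * ln t) with (alpha * ln t + - ln t) by ring.
      rewrite exp_plus, exp_Ropp, exp_ln by lra.
      field; lra.
    - apply (ex_derive_continuous (K := R_AbsRing) (V := R_NormedModule)).
      auto_derive; lra. }
  assert (B : Rabs (RInt phi e1 e2)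
      <= D / alpha * Rpower e2 alpha - D / alpha * Rpower e1 alpha).
  { refine (norm_RInt_le (V := R_NormedModule) phi _ e1 e2 _ _ _ _
      (RInt_correct (V := R_CompleteNormedModule) _ _ _ (Hex e1 e2 H1 H2)) I).
    - lra.
    - intros t Ht; apply Hb; lra. }
  assert (P := Rpower_gt0 e1 alpha).
  assert (0 <= D / alpha * Rpower e1 alpha) by (apply Rmult_le_pos; lra).
  lra. }
destruct (proj1 (filterlim_locally_cauchy (U := R_CompleteSpace) (F := at_right 0)
  (fun eps => RInt phi eps delta))) as [l Hl].
{ intros eps.
  destruct (Rpower_small alpha (D / alpha) eps Ha HDa (cond_pos eps)) as [eta Heta].
  exists (fun t => 0 < t < Rmin eta delta); split.
  { apply at_right_0_lt, Rmin_pos; [apply cond_pos|lra]. }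
  (* Two truncations differ by the integral between them, bounded through the larger one alone; the
     order of the two is settled afterwards by symmetry. *)
  assert (Hle : forall e1 e2, 0 < e1 -> e1 <= e2 < Rmin eta delta ->
    Rabs (RInt phi e1 delta - RInt phi e2 delta) < eps).
  { intros e1 e2 H1 H2.
    assert (Rmin eta delta <= eta) by apply Rmin_l.
    assert (Rmin eta delta <= delta) by apply Rmin_r.
    rewrite <- (RInt_Chasles (V := R_CompleteNormedModule) phi e1 e2 delta)
      by (apply Hex; lra).
    change plus with Rplus.
    rewrite Rplus_minus_r.
    eapply Rle_lt_trans; [apply Hint; lra|apply Heta; lra]. }
  intros e1 e2 H1 H2; change (Rabs (RInt phi e2 delta - RInt phi e1 delta) < eps).
  destruct (Rle_dec e1 e2).
  - rewrite Rabs_minus_sym; apply Hle; lra.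
  - apply Hle; lra. }
exists l; split; [exact Hl|].
apply Rle_plus_epsilon; intros e He.
destruct (filter_ex (F := at_right 0) _ (filter_and (F := at_right 0) _ _
  (proj1 (filterlim_locally _ _) Hl (mkposreal e He))
  (at_right_0_lt delta Hdelta))) as [t [H1 H2]].
change (Rabs (RInt phi t delta - l) < e) in H1.
assert (B := Hint t delta (proj1 H2) ltac:(lra)).
assert (T := Rabs_triang_inv l (RInt phi t delta)).
rewrite Rabs_minus_sym in H1; lra.
Qed.

(** * Splitting sums and integrals at the singular node *)

Lemma sum_n_m_around {G : AbelianMonoid} (F : nat -> G) (p q : nat) :
  F (S p) = zero ->
  sum_n_m F 1 (p + 1 + q)
  = plus (sum_n_m (fun k => F (p + 1 + k)%nat) 1 q)
         (sum_n_m (fun k => F (p + 1 - k)%nat) 1 p).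
Proof.
intros H0.
induction q as [|q IH].
- rewrite Nat.add_0_r, Nat.add_1_r, sum_n_Sm, H0, plus_zero_r by lia.
  rewrite (sum_n_m_zero _ 1 0) by lia; rewrite plus_zero_l.
  (* What remains for [q = 0] is the reversal of the sum over 1, ..., p. *)
  clear H0; induction p as [|p IH].
  + rewrite !sum_n_m_zero by lia; reflexivity.
  + rewrite sum_n_Sm, IH by lia.
    rewrite (sum_Sn_m _ 1 (S p)) by lia; rewrite plus_comm.
    apply f_equal2.
    * apply f_equal; lia.
    * rewrite <- sum_n_m_S; apply sum_n_m_ext_loc; intros k Hk; apply f_equal; lia.
- rewrite Nat.add_succ_r, !sum_n_Sm, IH by lia.
  rewrite <- plus_assoc, (plus_comm _ (F (S _))), plus_assoc.
  apply f_equal2; [|reflexivity].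
  apply f_equal2; [reflexivity|apply f_equal; lia].
Qed.

(** The substitutions y = x+t and y = x-t treat the two outer intervals; on the middle one the
    integrand is 0. *)
Lemma is_RInt_truncated (v : R -> R) (x A B eps : R) :
  (forall y, continuous v y) -> 0 < eps <= A -> eps <= B ->
  is_RInt (fun y => if Rlt_dec eps (Rabs (y - x)) then v y / (y - x) else 0)
    (x - A) (x + B)
    (RInt (fun t => v (x + t) / t) eps B - RInt (fun t => v (x - t) / t) eps A).
Proof.
intros Hv HA HB.
assert (Hr : forall t, continuous (fun t => v (x + t)) t).
{ intros t; apply (continuous_comp (fun t => x + t) v); [|apply Hv].
  apply (ex_derive_continuous (K := R_AbsRing) (V := R_NormedModule)); auto_derive; exact I. }
assert (Hl : forall t, continuous (fun t => v (x - t)) t).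
{ intros t; apply (continuous_comp (fun t => x - t) v); [|apply Hv].
  apply (ex_derive_continuous (K := R_AbsRing) (V := R_NormedModule)); auto_derive; exact I. }
assert (Ir := RInt_correct (V := R_CompleteNormedModule) _ _ _
  (ex_RInt_over_id _ eps B Hr ltac:(lra))).
assert (Il := is_RInt_swap _ _ _ _ (RInt_correct (V := R_CompleteNormedModule) _ _ _
  (ex_RInt_over_id _ eps A Hl ltac:(lra)))).
(* The end points are put into the affine form required by [is_RInt_comp_lin]; on the left the slope
   is -1, which is why [Il] was reversed. *)
replace eps with (1 * (x + eps) + - x) in Ir at 1 by ring.
replace B with (1 * (x + B) + - x) in Ir at 1 by ring.
apply (is_RInt_comp_lin (V := R_NormedModule)) in Ir.
replace A with (- 1 * (x - A) + x) in Il at 1 by ring.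
replace eps with (- 1 * (x - eps) + x) in Il at 1 by ring.
apply (is_RInt_comp_lin (V := R_NormedModule)) in Il.
assert (I0 := is_RInt_const (V := R_NormedModule) (x - eps) (x + eps) 0).
set (f := fun y => if Rlt_dec eps (Rabs (y - x)) then v y / (y - x) else 0).
assert (J1 : is_RInt f (x - A) (x - eps) (- RInt (fun t => v (x - t) / t) eps A)).
{ eapply is_RInt_ext; [|exact Il].
  intros y; rewrite Rmin_left, Rmax_right by lra; intros Hy; unfold f.
  destruct (Rlt_dec eps (Rabs (y - x))) as [|n].
  - unfold scal; simpl; unfold mult; simpl.
    replace (x - (- 1 * y + x)) with y by ring; field; lra.
  - rewrite Rabs_left in n; lra. }
assert (J2 : is_RInt f (x - eps) (x + eps) ((x + eps - (x - eps)) * 0)).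
{ eapply is_RInt_ext; [|exact I0].
  intros y; rewrite Rmin_left, Rmax_right by lra; intros Hy; unfold f.
  destruct (Rlt_dec eps (Rabs (y - x))) as [n|]; [|reflexivity].
  assert (Rabs (y - x) < eps) by (apply Rabs_def1; lra); lra. }
assert (J3 : is_RInt f (x + eps) (x + B) (RInt (fun t => v (x + t) / t) eps B)).
{ eapply is_RInt_ext; [|exact Ir].
  intros y; rewrite Rmin_left, Rmax_right by lra; intros Hy; unfold f.
  destruct (Rlt_dec eps (Rabs (y - x))) as [|n].
  - unfold scal; simpl; unfold mult; simpl.
    replace (x + (1 * y + - x)) with y by ring; field; lra.
  - rewrite Rabs_pos_eq in n; lra. }
assert (J := is_RInt_Chasles _ _ _ _ _ _ (is_RInt_Chasles _ _ _ _ _ _ J1 J2) J3).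
change plus with Rplus in J.
match type of J with is_RInt _ _ _ ?X => match goal with |- is_RInt _ _ _ ?Y =>
  replace Y with X by ring end end.
exact J.
Qed.

Lemma pv_quadrature_error (alpha H : R) (v : R -> R) (x h : R) (p q : nat) :
  0 < alpha <= 1 -> holder_on_R alpha H v -> 0 < h ->
  exists l : R,
    filterlim (fun eps => RInt (fun t => v (x + t) / t) eps ((INR q + 1 / 2) * h)
                          - RInt (fun t => v (x - t) / t) eps ((INR p + 1 / 2) * h))
      (at_right 0) (locally l) /\
    Rabs (l - (sum_n_m (fun k => v (x + INR k * h) / INR k) 1 q
               - sum_n_m (fun k => v (x - INR k * h) / INR k) 1 p))
    <= Rabs (v x) * (/ (INR p + 1 / 2) ^ 2 + / (INR q + 1 / 2) ^ 2)
       + 2 * H * Rpower h alpha *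
         (/ alpha + sum_n_m (fun k => / (INR k - 1 / 2)) 1 p
                  + sum_n_m (fun k => / (INR k - 1 / 2)) 1 q).
Proof.
intros Ha Hv Hh.
assert (HH := holder_const_ge0 _ _ _ Hv).
set (A := (INR p + 1 / 2) * h); set (B := (INR q + 1 / 2) * h).
assert (HA : h / 2 <= A).
{ assert (0 <= INR p * h) by (apply Rmult_le_pos; [apply pos_INR|lra]); unfold A; lra. }
assert (HB : h / 2 <= B).
{ assert (0 <= INR q * h) by (apply Rmult_le_pos; [apply pos_INR|lra]); unfold B; lra. }
assert (Hr : holder_on_R alpha H (fun t => v (x + t))).
{ intros s t; eapply Rle_trans; [apply Hv|].
  replace (x + s - (x + t)) with (s - t) by ring; lra. }
assert (Hl : holder_on_R alpha H (fun t => v (x - t))).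
{ intros s t; eapply Rle_trans; [apply Hv|].
  replace (x - s - (x - t)) with (- (s - t)) by ring; rewrite Rabs_Ropp; lra. }
assert (Hc : forall w, holder_on_R alpha H w -> forall t, continuous w t).
{ intros w Hw t; apply (holder_on_R_continuous alpha H); [lra|exact Hw]. }
assert (Er := midpoint_rule_error alpha H _ h q Ha Hr Hh).
assert (El := midpoint_rule_error alpha H _ h p Ha Hl Hh).
cbv beta in Er, El; fold B in Er; fold A in El.
rewrite Rplus_0_r in Er; rewrite Rminus_0_r in El.
(* The constant is [2 * H] because (2t)^alpha <= 2 t^alpha for alpha <= 1. *)
destruct (weakly_singular_limit alpha (2 * H) (h / 2)
  (fun t => v (x + t) / t - v (x - t) / t)) as [l0 [L0 B0]]; [lra|lra|lra| | |].
{ intros t Ht; apply (continuous_minus (V := R_NormedModule));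
    apply (continuous_mult (K := R_AbsRing));
    [apply (Hc _ Hr)|apply continuous_Rinv; lra|apply (Hc _ Hl)|apply continuous_Rinv; lra]. }
{ intros t Ht.
  replace (v (x + t) / t - v (x - t) / t) with ((v (x + t) - v (x - t)) * / t)
    by (field; lra).
  rewrite Rabs_mult, (Rabs_pos_eq (/ t)) by (left; apply Rinv_0_lt_compat; lra).
  replace (alpha - 1) with (alpha + - (1)) by ring.
  rewrite Rpower_plus, Rpower_Ropp, Rpower_1, <- Rmult_assoc by lra.
  apply Rmult_le_compat_r; [left; apply Rinv_0_lt_compat; lra|].
  eapply Rle_trans; [apply Hv|].
  replace (x + t - (x - t)) with (2 * t) by ring.
  rewrite Rabs_pos_eq, <- Rpower_mult_distr by lra.
  assert (P := Rpower_gt0 t alpha).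
  assert (Rpower 2 alpha <= 2).
  { rewrite <- (Rpower_1 2) at 2 by lra; apply Rle_Rpower; lra. }
  replace (2 * H * Rpower t alpha) with (H * (2 * Rpower t alpha)) by ring.
  apply Rmult_le_compat_l; [lra|apply Rmult_le_compat_r; lra]. }
exists (RInt (fun t => v (x + t) / t) (h / 2) B
        - RInt (fun t => v (x - t) / t) (h / 2) A + l0); split.
(* Once eps < h/2, both integrals split at h/2 and their inner parts merge into one weakly singular
   integral; neither of them need converge alone. *)
- apply (filterlim_ext_loc (fun eps =>
    RInt (fun t => v (x + t) / t) (h / 2) B - RInt (fun t => v (x - t) / t) (h / 2) A
    + RInt (fun t => v (x + t) / t - v (x - t) / t) eps (h / 2))).
  + apply (filter_imp (fun eps => 0 < eps < h / 2));
      [intros eps He|apply at_right_0_lt; lra].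
    assert (X1 : forall c, h / 2 <= c -> ex_RInt (fun t => v (x + t) / t) eps (h / 2)
                 /\ ex_RInt (fun t => v (x + t) / t) (h / 2) c).
    { intros c Hcc; split; apply (ex_RInt_over_id (fun t => v (x + t)));
        try exact (Hc _ Hr); lra. }
    assert (X2 : forall c, h / 2 <= c -> ex_RInt (fun t => v (x - t) / t) eps (h / 2)
                 /\ ex_RInt (fun t => v (x - t) / t) (h / 2) c).
    { intros c Hcc; split; apply (ex_RInt_over_id (fun t => v (x - t)));
        try exact (Hc _ Hl); lra. }
    destruct (X1 B HB) as [Y1 Y2]; destruct (X2 A HA) as [Y3 Y4].
    rewrite <- (RInt_Chasles (V := R_CompleteNormedModule) _ _ _ _ Y1 Y2).
    rewrite <- (RInt_Chasles (V := R_CompleteNormedModule) _ _ _ _ Y3 Y4).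
    assert (Em := RInt_minus (V := R_CompleteNormedModule) _ _ _ _ Y1 Y3).
    change (RInt (fun t => v (x + t) / t - v (x - t) / t) eps (h / 2)
      = RInt (fun t => v (x + t) / t) eps (h / 2)
        - RInt (fun t => v (x - t) / t) eps (h / 2)) in Em.
    rewrite Em.
    change plus with Rplus; ring.
  + exact (filterlim_comp_2 _ _ (plus (G := R_AbelianGroup)) (filterlim_const _) L0
      (filterlim_plus (K := R_AbsRing) (V := R_NormedModule) _ l0)).
- assert (D := sum_log_defect_diff p q).
  assert (Pp := Rpower_gt0 h alpha).
  assert (B0' : Rabs l0 <= 2 * H * Rpower h alpha * / alpha).
  { eapply Rle_trans; [exact B0|].
    replace (2 * H * Rpower h alpha * / alpha) with (2 * H / alpha * Rpower h alpha)
      by (field; lra).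
    apply Rmult_le_compat_l; [apply Rdiv_le_0_compat; lra|].
    apply Rle_Rpower_l; lra. }
  (* [X] and [Y] are the right and left midpoint errors with their defect terms subtracted; adding
     [v x * Z] restores the difference of these terms. *)
  match type of Er with Rabs ?X <= _ => match type of El with Rabs ?Y <= _ =>
  match type of D with Rabs ?Z <= _ =>
  match goal with |- Rabs ?T <= _ =>
    replace T with (X - Y + v x * Z + l0) by ring;
    assert (T1 := Rabs_triang (X - Y + v x * Z) l0);
    assert (T2 := Rabs_triang (X - Y) (v x * Z));
    assert (T3 := Rabs_triang X (- Y)); rewrite Rabs_Ropp in T3;
    assert (T4 := Rmult_le_compat_l _ _ _ (Rabs_pos (v x)) D);
    rewrite <- Rabs_mult in T4
  end end end end.
  unfold Rminus in *; lra.
Qed.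

(** * The Hoelder norm and the extension of u to the whole line *)

(** As [real] sends infinite values to 0, [Rsup] is meaningful only for a nonempty set that is
    bounded above. *)
Lemma Rsup_ub (E : R -> Prop) (B r : R) :
  (forall s, E s -> s <= B) -> E r -> r <= Rsup E.
Proof.
intros HB Hr; unfold Rsup.
destruct (Lub_Rbar_correct E) as [U L].
assert (Ur := U r Hr); assert (LB := L (Finite B) HB).
destruct (Lub_Rbar E); simpl in *; [exact Ur|contradiction|contradiction].
Qed.

Lemma Rpower_le_mono (s t alpha : R) :
  0 < alpha -> 0 < s <= t -> Rpower s alpha <= Rpower t alpha.
Proof. intros Ha Hs; apply Rle_Rpower_l; lra. Qed.

(** Both suprema are finite: the quotients are at most [K], and |u| is bounded by comparison with
    u(a). Since the supremum of |u| is nonnegative, the full norm dominates the seminorm. *)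
Lemma holder_norm_spec (alpha a b : R) (u : R -> C) :
  0 < alpha -> a < b -> holder alpha a b u ->
  0 <= holder_norm alpha a b u /\
  forall x y, a <= x <= b -> a <= y <= b -> x <> y ->
    Cmod (u x - u y) <= holder_norm alpha a b u * Rpower (Rabs (x - y)) alpha.
Proof.
intros Ha Hab [K HK]; unfold holder_norm.
set (s1 := Rsup (fun r => exists x, _)); set (s2 := Rsup _).
assert (HKq : forall x y, a <= x <= b -> a <= y <= b -> x <> y ->
  Cmod (u x - u y) / Rpower (Rabs (x - y)) alpha <= K).
{ intros x y Hx Hy Hn.
  apply Rle_div_l; [apply Rpower_gt0|apply HK; assumption]. }
assert (K0 : 0 <= K).
{ eapply Rle_trans; [|apply (HKq a b); lra].
  apply Rdiv_le_0_compat; [apply Cmod_ge_0|apply Rpower_gt0]. }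
assert (H1 : 0 <= s1).
{ eapply Rle_trans; [apply (Cmod_ge_0 (u a))|].
  apply (Rsup_ub _ (Cmod (u a) + K * Rpower (b - a) alpha)).
  - intros r [x [Hx ->]].
    assert (0 <= K * Rpower (b - a) alpha)
      by (apply Rmult_le_pos; [exact K0|left; apply Rpower_gt0]).
    destruct (Req_dec x a) as [->|Hn]; [lra|].
    assert (B := HK x a Hx ltac:(lra) Hn).
    assert (T := Cmod_triangle (u a) (u x - u a)).
    replace (u a + (u x - u a))%C with (u x) in T by ring.
    rewrite Rabs_pos_eq in B by lra.
    assert (P := Rpower_le_mono (x - a) (b - a) alpha Ha ltac:(lra)).
    assert (Q := Rmult_le_compat_l _ _ _ K0 P); lra.
  - exists a; split; [lra|reflexivity]. }
assert (H2 : forall x y, a <= x <= b -> a <= y <= b -> x <> y ->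
  Cmod (u x - u y) / Rpower (Rabs (x - y)) alpha <= s2).
{ intros x y Hx Hy Hn; apply (Rsup_ub _ K).
  - intros r [x' [y' [Hx' [Hy' [Hn' ->]]]]]; apply HKq; assumption.
  - exists x, y; repeat split; try assumption; apply Hx || apply Hy. }
split.
- assert (0 <= s2); [|lra].
  eapply Rle_trans; [|apply (H2 a b); lra].
  apply Rdiv_le_0_compat; [apply Cmod_ge_0|apply Rpower_gt0].
- intros x y Hx Hy Hn; apply Rle_div_l; [apply Rpower_gt0|].
  specialize (H2 x y Hx Hy Hn); lra.
Qed.

(* [u] is arbitrary outside [a,b]; composing with [clamp] keeps its Hoelder constant
   and makes it continuous on the whole line. *)
Definition clamp (a b y : R) : R := Rmax a (Rmin b y).

Lemma clamp_range (a b y : R) : a <= b -> a <= clamp a b y <= b.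
Proof.
intros H; unfold clamp, Rmax, Rmin.
repeat destruct (Rle_dec _ _); lra.
Qed.

Lemma clamp_id (a b y : R) : a <= y <= b -> clamp a b y = y.
Proof.
intros H; unfold clamp, Rmax, Rmin.
repeat destruct (Rle_dec _ _); lra.
Qed.

Lemma clamp_dist (a b x y : R) : a <= b ->
  Rabs (clamp a b x - clamp a b y) <= Rabs (x - y).
Proof.
intros H; unfold clamp, Rmax, Rmin, Rabs.
repeat destruct (Rle_dec _ _); repeat destruct (Rcase_abs _); lra.
Qed.

(** Neither [clamp] nor [pr], which will be [fst] or [snd], increases distances. *)
Lemma holder_on_R_clamp (alpha H a b : R) (u : R -> C) (pr : C -> R) :
  (forall z w, pr z - pr w = pr (z - w)%C) ->
  (forall z, Rabs (pr z) <= Cmod z) ->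
  0 < alpha -> a < b -> 0 <= H ->
  (forall x y, a <= x <= b -> a <= y <= b -> x <> y ->
    Cmod (u x - u y) <= H * Rpower (Rabs (x - y)) alpha) ->
  holder_on_R alpha H (fun y => pr (u (clamp a b y))).
Proof.
intros Hsub Hpr Ha Hab H0 Hu x y.
rewrite Hsub; eapply Rle_trans; [apply Hpr|].
(* Distinct points may be clamped to the same one, where the assumption on [u] is silent. *)
destruct (Req_dec (clamp a b x) (clamp a b y)) as [E|Hn].
- rewrite E.
  replace (u (clamp a b y) - u (clamp a b y))%C with (RtoC 0) by ring.
  rewrite Cmod_0; apply Rmult_le_pos; [exact H0|left; apply Rpower_gt0].
- eapply Rle_trans; [apply Hu; try exact Hn; apply clamp_range; lra|].
  apply Rmult_le_compat_l; [exact H0|].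
  apply Rpower_le_mono; [exact Ha|].
  split; [apply Rabs_pos_lt; lra|apply clamp_dist; lra].
Qed.

(** * Reduction of the complex error to real and imaginary parts *)

Lemma sum_n_m_pair (F : nat -> C) (m : nat) :
  sum_n_m (G := C_AbelianMonoid) F 1 m
  = (sum_n_m (fun n => fst (F n)) 1 m, sum_n_m (fun n => snd (F n)) 1 m).
Proof.
induction m as [|m IH].
- rewrite !sum_n_m_zero by lia; reflexivity.
- rewrite !sum_n_Sm, IH by lia; reflexivity.
Qed.

Lemma Cdiv_real_diff (z : C) (s t : R) : s <> t ->
  (z / (RtoC s - RtoC t))%C = (fst z / (s - t), snd z / (s - t)).
Proof.
intros H; rewrite <- RtoC_minus.
unfold Cdiv, Cinv, Cmult; simpl; f_equal; field; lra.
Qed.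

(** The nodes lie at distance kh from x, so the weight h cancels; the denominators on the left are
    negative, whence the minus sign. *)
Lemma midpoint_quadrature_split (v : R -> R) (x h : R) (p q : nat) (X : nat -> R) :
  0 < h -> (forall n, X n = x + (INR n - INR (p + 1)) * h) ->
  h * sum_n_m (fun n => if Nat.eqb n (p + 1) then 0 else v (X n) / (X n - x))
        1 (p + 1 + q)
  = sum_n_m (fun k => v (x + INR k * h) / INR k) 1 q
    - sum_n_m (fun k => v (x - INR k * h) / INR k) 1 p.
Proof.
intros Hh HX.
rewrite sum_n_m_around by (rewrite (proj2 (Nat.eqb_eq _ _)) by lia; reflexivity).
change plus with Rplus; rewrite Rmult_plus_distr_l; unfold Rminus at 3.
rewrite <- !(sum_n_m_mult_l (K := R_Ring) h).
replace (- sum_n_m (fun k => v (x - INR k * h) / INR k) 1 p)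
  with (mult (K := R_Ring) (- 1) (sum_n_m (fun k => v (x - INR k * h) / INR k) 1 p))
  by (unfold mult; simpl; ring).
rewrite <- (sum_n_m_mult_l (K := R_Ring) (- 1)).
f_equal; apply sum_n_m_ext_loc; intros k Hk; unfold mult; simpl;
  rewrite (proj2 (Nat.eqb_neq _ _)) by lia; rewrite HX;
  assert (1 <= INR k) by (apply (le_INR 1); lia).
- rewrite (plus_INR (p + 1)).
  replace (x + (INR (p + 1) + INR k - INR (p + 1)) * h) with (x + INR k * h) by ring.
  field; nra.
- rewrite minus_INR by lia.
  replace (x + (INR (p + 1) - INR k - INR (p + 1)) * h) with (x - INR k * h) by ring.
  field; nra.
Qed.

(** Integrals and limits are taken componentwise; as [pv] is defined through [iota], uniqueness of
    the limit is needed as well as its existence. *)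
Lemma pv_pair (f : R -> C) (a b x d : R) (l : C) (f1 f2 : R -> R) (I1 I2 : R -> R) :
  0 < d ->
  (forall eps, 0 < eps < d ->
    is_RInt (fun y => if Rlt_dec eps (Rabs (y - x)) then f1 y else 0) a b (I1 eps)) ->
  (forall eps, 0 < eps < d ->
    is_RInt (fun y => if Rlt_dec eps (Rabs (y - x)) then f2 y else 0) a b (I2 eps)) ->
  (forall y, Rmin a b < y < Rmax a b -> y <> x -> f y = (f1 y, f2 y)) ->
  filterlim I1 (at_right 0) (locally (fst l)) ->
  filterlim I2 (at_right 0) (locally (snd l)) ->
  pv f a b x = l.
Proof.
intros Hd H1 H2 Hf L1 L2; unfold pv.
assert (HI : forall eps, 0 < eps < d ->
  RInt (V := C_R_CompleteNormedModule) (cut_off f x eps) a b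
  = (I1 eps, I2 eps)).
{ intros eps He.
  apply (is_RInt_unique (V := C_R_CompleteNormedModule)).
  assert (E : forall y, Rmin a b < y < Rmax a b ->
    cut_off f x eps y
    = (if Rlt_dec eps (Rabs (y - x)) then f1 y else 0,
       if Rlt_dec eps (Rabs (y - x)) then f2 y else 0)).
  { intros y Hy; unfold cut_off.
    destruct (Rlt_dec eps (Rabs (y - x))) as [Hlt|]; [|reflexivity].
    apply Hf; [exact Hy|].
    intros ->; replace (x - x) with 0 in Hlt by ring; rewrite Rabs_R0 in Hlt; lra. }
  apply (is_RInt_fct_extend_pair (U := R_NormedModule) (V := R_NormedModule)).
  - eapply is_RInt_ext; [|exact (H1 eps He)]; intros y Hy; cbv beta; rewrite (E y Hy); reflexivity.
  - eapply is_RInt_ext; [|exact (H2 eps He)]; intros y Hy; cbv beta; rewrite (E y Hy); reflexivity. }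
assert (L : is_pv f a b x l).
{ unfold is_pv.
  eapply filterlim_ext_loc.
  - apply (filter_imp (fun eps => 0 < eps < d)); [|apply at_right_0_lt; exact Hd].
    intros eps He; symmetry; exact (HI eps He).
  - apply (filterlim_locally (U := C_R_CompleteNormedModule)); intros eps.
    apply (filter_and (F := at_right 0)).
    + exact (proj1 (filterlim_locally _ _) L1 eps).
    + exact (proj1 (filterlim_locally _ _) L2 eps). }
apply (iota_unique (V := C_R_CompleteNormedModule)); [|exact L].
intros y Hy.
apply (filterlim_locally_unique (K := R_AbsRing) (V := C_R_NormedModule)
  (F := at_right 0) _ y l Hy L).
Qed.

Lemma Cmod_le_twice (z : C) (B : R) :
  Rabs (fst z) <= B -> Rabs (snd z) <= B -> Cmod z <= 2 * B.
Proof.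
intros H1 H2.
assert (T := Cmod_triangle (RtoC (fst z)) (Ci * RtoC (snd z))).
rewrite Cmod_mult, Cmod_Ci, !Cmod_R in T.
replace (RtoC (fst z) + Ci * RtoC (snd z))%C with z in T.
- lra.
- destruct z as [s t]; unfold Ci, RtoC, Cplus, Cmult; simpl; f_equal; ring.
Qed.

Lemma Cmod_div_iPI_le (z : C) : Cmod (1 / (Ci * PI) * z)%C <= Cmod z.
Proof.
assert (HP := PI2_1).
assert (HP0 : RtoC PI <> 0) by (intros E; apply RtoC_inj in E; lra).
assert (HC : (Ci * PI)%C <> 0) by (apply Cmult_neq_0; [intros E; apply (f_equal snd) in E; simpl in E; lra|exact HP0]).
rewrite Cmod_mult, Cmod_div, Cmod_mult, Cmod_Ci, !Cmod_R by exact HC.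
rewrite Rabs_R1, Rabs_pos_eq by lra.
rewrite <- (Rmult_1_l (Cmod z)) at 2.
apply Rmult_le_compat_r; [apply Cmod_ge_0|].
apply Rle_div_l; lra.
Qed.

(** The real estimate is applied to both components of the clamped function; the outer factor 2
    comes from adding them, and 1/pi <= 1 absorbs the prefactor. *)
Lemma consistency_error_le (alpha a b H : R) (N p q : nat) (u : R -> C) :
  0 < alpha <= 1 -> a < b -> (2 <= N)%nat -> 0 <= H ->
  b - a = INR (p + 1 + q) * mesh N ->
  (forall x y, a <= x <= b -> a <= y <= b -> x <> y ->
    Cmod (u x - u y) <= H * Rpower (Rabs (x - y)) alpha) ->
  Cmod (consistency_error a b N (p + 1 + q) u (p + 1))
  <= 2 * (Cmod (u (midpoint a N (p + 1)))
            * (/ (INR p + 1 / 2) ^ 2 + / (INR q + 1 / 2) ^ 2)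
          + 2 * H * Rpower (mesh N) alpha *
            (/ alpha + sum_n_m (fun k => / (INR k - 1 / 2)) 1 p
                     + sum_n_m (fun k => / (INR k - 1 / 2)) 1 q)).
Proof.
intros Ha Hab HN H0 Hba Hu.
assert (Hh : 0 < mesh N) by (apply Rdiv_lt_0_compat; [lra|apply lt_0_INR; lia]).
set (h := mesh N) in *; set (x := midpoint a N (p + 1)).
assert (Ex : x = a + (INR p + 1 / 2) * h)
  by (unfold x, midpoint; fold h; rewrite plus_INR; simpl; field).
rewrite !plus_INR in Hba; simpl in Hba.
assert (Ea : a = x - (INR p + 1 / 2) * h) by lra.
assert (Eb : b = x + (INR q + 1 / 2) * h) by lra.
assert (Pp : 0 <= INR p * h) by (apply Rmult_le_pos; [apply pos_INR|lra]).
assert (Pq : 0 <= INR q * h) by (apply Rmult_le_pos; [apply pos_INR|lra]).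
assert (V1 := holder_on_R_clamp alpha H a b u fst (fun _ _ => eq_refl)
  (fun z => Rle_trans _ _ _ (Rmax_l _ _) (Rmax_Cmod z)) (proj1 Ha) Hab H0 Hu).
assert (V2 := holder_on_R_clamp alpha H a b u snd (fun _ _ => eq_refl)
  (fun z => Rle_trans _ _ _ (Rmax_r _ _) (Rmax_Cmod z)) (proj1 Ha) Hab H0 Hu).
set (v1 := fun y => fst (u (clamp a b y))) in *.
set (v2 := fun y => snd (u (clamp a b y))) in *.
destruct (pv_quadrature_error alpha H v1 x h p q Ha V1 Hh) as [l1 [L1 B1]].
destruct (pv_quadrature_error alpha H v2 x h p q Ha V2 Hh) as [l2 [L2 B2]].
assert (Hv : forall y, a <= y <= b -> u y = (v1 y, v2 y)).
{ intros y Hy; unfold v1, v2; rewrite clamp_id by exact Hy; apply surjective_pairing. }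
assert (EP : pv (fun y => (u y / (RtoC y - RtoC x))%C) a b x = (l1, l2)).
{ apply (pv_pair _ a b x (h / 2) (l1, l2)
    (fun y => v1 y / (y - x)) (fun y => v2 y / (y - x))
    (fun eps => RInt (fun t => v1 (x + t) / t) eps ((INR q + 1 / 2) * h)
              - RInt (fun t => v1 (x - t) / t) eps ((INR p + 1 / 2) * h))
    (fun eps => RInt (fun t => v2 (x + t) / t) eps ((INR q + 1 / 2) * h)
              - RInt (fun t => v2 (x - t) / t) eps ((INR p + 1 / 2) * h)));
    [lra| | | |exact L1|exact L2].
  - intros eps He; rewrite Ea at 1; rewrite Eb at 1.
    apply is_RInt_truncated; [|lra|lra].
    intros y; apply (holder_on_R_continuous alpha H); [lra|exact V1].
  - intros eps He; rewrite Ea at 1; rewrite Eb at 1.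
    apply is_RInt_truncated; [|lra|lra].
    intros y; apply (holder_on_R_continuous alpha H); [lra|exact V2].
  - intros y; rewrite Rmin_left, Rmax_right by lra; intros Hy Hn.
    rewrite Cdiv_real_diff, Hv by lra; reflexivity. }
assert (HX : forall n, midpoint a N n = x + (INR n - INR (p + 1)) * h).
{ intros n; unfold x, midpoint; fold h; ring. }
assert (EQ : quadrature_sum a N (p + 1 + q) u (p + 1) =
  (sum_n_m (fun k => v1 (x + INR k * h) / INR k) 1 q
     - sum_n_m (fun k => v1 (x - INR k * h) / INR k) 1 p,
   sum_n_m (fun k => v2 (x + INR k * h) / INR k) 1 q
     - sum_n_m (fun k => v2 (x - INR k * h) / INR k) 1 p)).
{ rewrite <- !(midpoint_quadrature_split _ x h p q (midpoint a N) Hh HX).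
  (* All nodes lie in [a,b], where clamping changes nothing. *)
  assert (Hterm : forall n, (1 <= n <= p + 1 + q)%nat ->
    (if Nat.eqb n (p + 1) then RtoC 0
     else (u (midpoint a N n) / (RtoC (midpoint a N n) - RtoC x))%C)
    = (if Nat.eqb n (p + 1) then 0 else v1 (midpoint a N n) / (midpoint a N n - x),
       if Nat.eqb n (p + 1) then 0 else v2 (midpoint a N n) / (midpoint a N n - x))).
  { intros n Hn; destruct (Nat.eqb_spec n (p + 1)) as [|Hne]; [reflexivity|].
    assert (Hd : INR n - INR (p + 1) <> 0)
      by (intros E; apply Hne, INR_eq; lra).
    rewrite Cdiv_real_diff, Hv; [reflexivity| |].
    - assert (1 <= INR n) by (apply (le_INR 1); lia).
      assert (INR n <= INR p + 1 + INR q)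
        by (change 1 with (INR 1); rewrite <- !plus_INR; apply le_INR; lia).
      unfold midpoint; fold h; split; nra.
    - rewrite HX; intros E; apply Hd; apply (Rmult_eq_reg_r h); lra. }
  unfold quadrature_sum; fold h x.
  assert (ES := sum_n_m_ext_loc (G := C_AbelianMonoid) _ _ _ _ Hterm).
  rewrite (sum_n_m_pair (fun n => (_, _))) in ES.
  refine (eq_trans (f_equal (Cmult (RtoC h)) ES) _).
  unfold Cmult, RtoC; cbn [fst snd].
  rewrite !Rmult_0_l, Rminus_0_r, Rplus_0_r; reflexivity. }
unfold consistency_error; fold x.
eapply Rle_trans; [apply Cmod_div_iPI_le|].
rewrite EP, EQ.
assert (Hx : a <= x <= b) by lra.
assert (HW : 0 <= / (INR p + 1 / 2) ^ 2 + / (INR q + 1 / 2) ^ 2).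
{ assert (0 <= INR p) by apply pos_INR; assert (0 <= INR q) by apply pos_INR.
  apply Rplus_le_le_0_compat; left; apply Rinv_0_lt_compat, pow_lt; lra. }
apply Cmod_le_twice; unfold Cminus, Cplus, Copp; cbn [fst snd];
  (eapply Rle_trans; [exact B1 || exact B2|]);
  apply Rplus_le_compat_r, Rmult_le_compat_r; try exact HW; rewrite Hv by exact Hx.
- exact (Rle_trans _ _ _ (Rmax_l _ _) (Rmax_Cmod _)).
- exact (Rle_trans _ _ _ (Rmax_r _ _) (Rmax_Cmod _)).
Qed.

(** * The boundary weight and the final estimate *)

(** For P <= 1 use P^alpha <= 1 and 1/P^2 <= 4; for P > 1 use P^alpha <= P <= P^2. *)
Lemma inv_sq_Rpower_le (alpha P : R) : 0 < alpha <= 1 -> 1 / 2 <= P ->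
  Rpower P alpha * / P ^ 2 <= 4.
Proof.
intros Ha HP.
apply (Rle_div_l _ _ (P ^ 2)); [apply pow_lt; lra|].
destruct (Rle_dec P 1).
- assert (Rpower P alpha <= Rpower 1 alpha) by (apply Rpower_le_mono; lra).
  replace (Rpower 1 alpha) with 1 in *
    by (unfold Rpower; rewrite ln_1, Rmult_0_r, exp_0; reflexivity).
  nra.
- assert (Rpower P alpha <= Rpower P 1) by (apply Rle_Rpower; lra).
  rewrite Rpower_1 in * by lra; nra.
Qed.

(** Meant for m = |u(x)| and d the distance of x from an end point where u vanishes. *)
Lemma boundary_value_le (alpha H h P m d : R) :
  0 < alpha <= 1 -> 0 <= H -> 0 < h -> 1 / 2 <= P -> d = P * h ->
  m <= H * Rpower d alpha ->
  m * / P ^ 2 <= 4 * (H * Rpower h alpha).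
Proof.
intros Ha HH Hh HP -> Hm.
rewrite <- Rpower_mult_distr in Hm by lra.
assert (Hi : 0 < / P ^ 2) by (apply Rinv_0_lt_compat, pow_lt; lra).
assert (B := inv_sq_Rpower_le alpha P Ha HP).
assert (Q := Rpower_gt0 h alpha).
apply (Rle_trans _ (H * (Rpower P alpha * Rpower h alpha) * / P ^ 2)).
- apply Rmult_le_compat_r; lra.
- replace (H * (Rpower P alpha * Rpower h alpha) * / P ^ 2)
    with (H * Rpower h alpha * (Rpower P alpha * / P ^ 2)) by ring.
  rewrite (Rmult_comm 4); apply Rmult_le_compat_l; [apply Rmult_le_pos; lra|exact B].
Qed.

(** The right-hand side is (1/P + 1/Q)^2. With Ph and Qh the distances to the end points, (P+Q)h is
    the length b-a. *)
Lemma inv_sq_sum_le (P Q h : R) : 0 < P -> 0 < Q -> 0 < h ->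
  / P ^ 2 + / Q ^ 2 <= ((P + Q) * h) ^ 2 * (h ^ 2 / ((P * h) ^ 2 * (Q * h) ^ 2)).
Proof.
intros HP HQ Hh.
replace (((P + Q) * h) ^ 2 * (h ^ 2 / ((P * h) ^ 2 * (Q * h) ^ 2)))
  with (/ P ^ 2 + / Q ^ 2 + 2 * / (P * Q)) by (field; lra).
assert (0 < / (P * Q)) by (apply Rinv_0_lt_compat, Rmult_lt_0_compat; lra).
lra.
Qed.

(* N = 1 is left out: there h = 1, so |log h| = 0 and the bounds are false. *)
Theorem proposition3p2 (alpha a b : R) (alpha_range : 0 < alpha <= 1) (a_lt_b : a < b) :
  exists K : R,
    forall (N M : nat) (N_ge2 : (2 <= N)%nat) (ba_eq : b - a = INR M * mesh N)
           (u : R -> C) (u_holder : holder alpha a b u)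
           (j : nat) (j_range : (1 <= j <= M)%nat),
      Cmod (consistency_error a b N M u j) <=
        K * (Rpower (mesh N) alpha * Rabs (ln (mesh N)) * holder_norm alpha a b u
             + Cmod (u (midpoint a N j)) *
               (mesh N ^ 2 /
                ((midpoint a N j - a) ^ 2 * (b - midpoint a N j) ^ 2)))
      /\
      (u a = RtoC 0 -> u b = RtoC 0 ->
       Cmod (consistency_error a b N M u j) <=
         K * (Rpower (mesh N) alpha * Rabs (ln (mesh N)) * holder_norm alpha a b u)).
Proof.
(* The two half-harmonic sums give at most 4 + 4 ln M, where ln M = ln(b-a) + ln N; every constant
   is then multiplied by 2 ln N > 1. *)
set (L := 2 / alpha + 12 + 8 * Rabs (ln (b - a))).
(* The three terms pay for the boundary weight, for the logarithmic sum, and for the weight when u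
   vanishes at the ends: there 2(4+4) = 16, doubled by 1 <= 2 ln N. *)
exists (2 * (b - a) ^ 2 + 4 * L + 32).
intros N M HN Hba u Hu j Hj.
destruct (holder_norm_spec alpha a b u (proj1 alpha_range) a_lt_b Hu) as [H0 HH].
set (nrm := holder_norm alpha a b u) in *.
assert (HNR : 0 < INR N) by (apply lt_0_INR; lia).
assert (Hh : 0 < mesh N) by (apply Rdiv_lt_0_compat; lra).
set (p := (j - 1)%nat); set (q := (M - j)%nat).
assert (Ej : j = (p + 1)%nat) by (unfold p; lia).
assert (EM : M = (p + 1 + q)%nat) by (unfold p, q; lia).
assert (C0 := consistency_error_le alpha a b nrm N p q u alpha_range a_lt_b HN H0
  ltac:(rewrite <- EM; exact Hba) HH).
rewrite <- EM, <- Ej in C0.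
assert (Eln : Rabs (ln (mesh N)) = ln (INR N) /\ / 2 < ln (INR N)).
{ assert (/ 2 < ln (INR N)).
  { eapply Rlt_le_trans; [exact ln_lt_2|].
    apply Rcomplements.ln_le; [lra|apply (le_INR 2); exact HN]. }
  split; [|assumption].
  unfold mesh, Rdiv; rewrite Rmult_1_l, ln_Rinv, Rabs_Ropp, Rabs_pos_eq by lra.
  reflexivity. }
destruct Eln as [-> Hln].
assert (ElnM : ln (INR M) = ln (b - a) + ln (INR N)).
{ rewrite <- ln_mult by lra; f_equal; rewrite Hba; unfold mesh; field; lra. }
assert (Sp := sum_half_harmonic_le p M ltac:(lia)).
assert (Sq := sum_half_harmonic_le q M ltac:(lia)).
assert (HT : / alpha + sum_n_m (fun k => / (INR k - 1 / 2)) 1 p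
                     + sum_n_m (fun k => / (INR k - 1 / 2)) 1 q <= L * ln (INR N)).
{ assert (Hia : 0 < / alpha) by (apply Rinv_0_lt_compat; lra).
  assert (A1 := Rle_abs (ln (b - a))); assert (A2 := Rabs_pos (ln (b - a))).
  assert (X1 : / alpha * 1 <= / alpha * (2 * ln (INR N)))
    by (apply Rmult_le_compat_l; lra).
  assert (X2 : Rabs (ln (b - a)) * 1 <= Rabs (ln (b - a)) * (2 * ln (INR N)))
    by (apply Rmult_le_compat_l; lra).
  unfold L, Rdiv; lra. }
assert (Pp := pos_INR p); assert (Pq := pos_INR q).
assert (Ha := Rpower_gt0 (mesh N) alpha).
set (h := mesh N) in *; set (x := midpoint a N j) in *.
assert (Exa : x - a = (INR p + 1 / 2) * h).
{ unfold x, midpoint; fold h; rewrite Ej, plus_INR; simpl; field. }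
assert (Exb : b - x = (INR q + 1 / 2) * h).
{ assert (E := Hba); rewrite EM, !plus_INR in E; simpl in E; lra. }
assert (Hpx : 0 <= INR p * h) by (apply Rmult_le_pos; lra).
assert (Hqx : 0 <= INR q * h) by (apply Rmult_le_pos; lra).
assert (Hux := Cmod_ge_0 (u x)).
assert (HY : 0 <= Rpower h alpha * ln (INR N) * nrm)
  by (apply Rmult_le_pos; [apply Rmult_le_pos; lra|exact H0]).
assert (L0 : 0 <= L).
{ assert (A2 := Rabs_pos (ln (b - a))).
  assert (0 < 2 / alpha) by (apply Rdiv_lt_0_compat; lra); unfold L; lra. }
set (W := / (INR p + 1 / 2) ^ 2 + / (INR q + 1 / 2) ^ 2) in *.
assert (C1 : Cmod (consistency_error a b N M u j)
   <= 2 * (Cmod (u x) * W) + 4 * L * (Rpower h alpha * ln (INR N) * nrm)).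
{ eapply Rle_trans; [exact C0|].
  assert (X : 2 * nrm * Rpower h alpha *
    (/ alpha + sum_n_m (fun k => / (INR k - 1 / 2)) 1 p
             + sum_n_m (fun k => / (INR k - 1 / 2)) 1 q)
    <= 2 * nrm * Rpower h alpha * (L * ln (INR N))).
  { apply Rmult_le_compat_l; [apply Rmult_le_pos; lra|exact HT]. }
  lra. }
assert (HLY := Rmult_le_pos _ _ L0 HY).
assert (HbY := Rmult_le_pos _ _ (pow2_ge_0 (b - a)) HY).
split.
- assert (HW : W <= (b - a) ^ 2 * (h ^ 2 / ((x - a) ^ 2 * (b - x) ^ 2))).
  { rewrite Exa, Exb.
    replace (b - a) with ((INR p + 1 / 2 + (INR q + 1 / 2)) * h) by lra.
    apply inv_sq_sum_le; lra. }
  set (Z := h ^ 2 / ((x - a) ^ 2 * (b - x) ^ 2)) in *.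
  assert (HZ : 0 <= Z).
  { apply Rdiv_le_0_compat; [apply pow2_ge_0|].
    apply Rmult_lt_0_compat; apply pow_lt; lra. }
  assert (X := Rmult_le_compat_l _ _ _ Hux HW).
  assert (HuZ := Rmult_le_pos _ _ Hux HZ).
  assert (HLZ := Rmult_le_pos _ _ L0 HuZ).
  lra.
- intros Hua Hub.
  assert (Da : Cmod (u x) <= nrm * Rpower (x - a) alpha).
  { replace (u x) with (u x - u a)%C by (rewrite Hua; ring).
    rewrite <- (Rabs_pos_eq (x - a)) by lra; apply HH; lra. }
  assert (Db : Cmod (u x) <= nrm * Rpower (b - x) alpha).
  { replace (u x) with (u x - u b)%C by (rewrite Hub; ring).
    rewrite <- (Rabs_pos_eq (b - x)), Rabs_minus_sym by lra; apply HH; lra. }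
  assert (Ba := boundary_value_le alpha nrm h (INR p + 1 / 2) _ _ alpha_range H0 Hh
    ltac:(lra) Exa Da).
  assert (Bb := boundary_value_le alpha nrm h (INR q + 1 / 2) _ _ alpha_range H0 Hh
    ltac:(lra) Exb Db).
  (* Turns the boundary contribution, which is O(h^alpha) without a logarithm, into O(h^alpha |log
     h|). *)
  assert (X : 0 <= nrm * Rpower h alpha * (2 * ln (INR N) - 1))
    by (apply Rmult_le_pos; [apply Rmult_le_pos; lra|lra]).
  unfold W in C1; lra.
Qed.
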